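(* Let $G$ be a finite graph with $\operatorname{mad}(G)<4$ and $\Delta(G) \geqslant 8$. Then $\chi(G^2)\leqslant 3\Delta(G)+1$.
   Context: $\Delta(G)$ is the maximum degree of $G$. The maximum average degree is $\operatorname{mad}(G)=\max\{2|E(H)|/|V(H)| : H \subseteq G\}$ over (nonempty) subgraphs $H$ of $G$. The square $G^2$ is the graph on $V(G)$ in which two distinct vertices are adjacent if and only if their distance in $G$ is at most $2$; $\chi(G^2)$ is the chromatic number of $G^2$, i.e. the least $k$ such that $G^2$ admits a proper vertex coloring with $k$ colors. *)

(* Defs.v *)
From mathcomp Require Import all_boot all_order all_algebra.

Set Implicit Arguments.
Unset Strict Implicit.
Unset Printing Implicit Defensive.

Import Order.TTheory GRing.Theory Num.Theory.

(* A finite simple graph is a finType T of vertices together with a symmetric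
   irreflexive adjacency relation e : rel T. *)
Section Graph.
Variables (T : finType) (e : rel T).

Definition edges : {set {set T}} :=
  [set [set p.1; p.2] | p : T * T in [set q : T * T | e q.1 q.2]].

Definition degree (x : T) : nat := #|[set y | e x y]|.

Definition max_degree : nat := \max_(x : T) degree x.

(* A subgraph, not necessarily induced, is a pair H = (V(H), E(H)). *)
Definition is_subgraph (H : {set T} * {set {set T}}) : bool :=
  (H.2 \subset edges) && [forall f in H.2, f \subset H.1].

Definition average_degree (H : {set T} * {set {set T}}) : rat :=
  ((2 * #|H.2|)%:R / #|H.1|%:R)%R.

(* Average degrees are nonnegative, so the default value 0 matters only for
   the graph with no vertices. *)
Definition mad : rat :=
  \big[Num.max/0%R]_(H : {set T} * {set {set T}} |
                     is_subgraph H && (H.1 != set0)) average_degree H.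

Definition walk (n : nat) (x y : T) : bool :=
  [exists p : n.-tuple T, path e x p && (last x p == y)].

(* The least length of a walk from x to y; None stands for infinite distance.
   A shortest walk repeats no vertex, so its length is less than #|T|. *)
Definition dist (x y : T) : option nat :=
  ohead [seq n <- iota 0 #|T| | walk n x y].

Definition square : rel T :=
  fun x y => (x != y) && (if dist x y is Some d then d <= 2 else false).

Definition colorable (k : nat) : bool :=
  [exists c : {ffun T -> 'I_k}, forall x, forall y, e x y ==> (c x != c y)].

(* The identity coloring uses #|T| colors.  Irreflexivity is needed: a graph
   with a loop has no proper coloring. *)
Lemma ex_colorable : irreflexive e -> exists k, colorable k.
Proof.
move=> irr; exists #|T|; apply/existsP; exists [ffun x => enum_rank x].
apply/forallP=> x; apply/forallP=> y; apply/implyP=> exy; rewrite !ffunE.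
by apply/eqP=> /enum_rank_inj eq_xy; rewrite eq_xy irr in exy.
Qed.

Definition chromatic_number (irr : irreflexive e) : nat :=
  ex_minn (ex_colorable irr).

End Graph.

Lemma square_irr (T : finType) (e : rel T) : irreflexive (square e).
Proof. by move=> x; rewrite /square eqxx. Qed.

(* Main.v *)
(* Call a vertex light if its degree is at most 3, write A for the set of the
   other vertices and m(v) for the number of neighbours of v in A.  Light
   vertices have at most 3D vertices at distance at most 2, so they can always
   be coloured last.  Hence, by induction on the number of edges, G^2 is
   (3D+1)-colourable as soon as some edge uv has u light and v either light or
   with at most 3D vertices of A at distance at most 2: colour the square of
   G - uv, erase the light vertices and v, and recolour greedily.
   If there is no such edge, then light vertices are independent and every v in
   A with a light neighbour satisfies
     3D + 1 <= (sum of m(z) over the neighbours z of v in A)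
               + #(light neighbours) + #(neighbours of degree 3).
   Give each v in A the charge m(v) - 4 + (2/3) #(neighbours of degree 3).  As
   mad(G) < 4, applied to A together with the vertices of degree 3, the total
   charge is negative.  But the inequality above shows that a vertex with
   m(v) <= 2 has charge at least 0, and that one with m(v) = 3 and negative
   charge has neighbours in A with sum of m(z) at least 2D + 3; such
   neighbours can pay for it if each z in A distributes m(z) - 4 evenly. *)

Require Import Defs.
From mathcomp Require Import all_boot all_order all_algebra.
From mathcomp Require Import zify.

Set Implicit Arguments.
Unset Strict Implicit.
Unset Printing Implicit Defensive.

Import Order.TTheory GRing.Theory Num.Theory.

Definition deg_in (T : finType) (e : rel T) (S : {set T}) (x : T) : nat :=
  #|[set y in S | e x y]|.

(** * Greedy extension of partial colourings *)

Section Greedy.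
Variables (T : finType) (f : rel T) (k : nat).

(** Values of [c] outside [S] are ignored, so erasing colours means shrinking [S]. *)
Definition proper_on (S : {set T}) (c : T -> 'I_k) :=
  forall x y, x \in S -> y \in S -> f x y -> c x != c y.

Hypotheses (f_sym : symmetric f) (f_irr : irreflexive f).

Lemma proper_on_setU1 (S : {set T}) (v : T) (c : T -> 'I_k) :
  proper_on S c -> #|[set y in S | f v y]| < k ->
  exists c' : T -> 'I_k, proper_on (v |: S) c'.
Proof.
move=> cP ltk; pose C := c @: [set y in S | f v y].
have [i iC] : exists i, i \in ~: C.
  apply/set0Pn; rewrite -card_gt0 cardsCs setCK card_ord subn_gt0.
  exact: leq_ltn_trans (leq_imset_card _ _) ltk.
have iN y : y \in S -> f v y -> i != c y.
  move=> yS fvy; apply: contraTneq iC => ->.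
  by rewrite inE negbK; apply: imset_f; rewrite inE yS.
exists (fun x => if x == v then i else c x) => x y; rewrite !inE.
case: eqVneq => [->|xv] /=; case: eqVneq => [->|yv] //= xS yS fxy.
- by rewrite f_irr in fxy.
- exact: iN.
- by rewrite eq_sym iN // f_sym.
- exact: cP.
Qed.

(** The bound counts all neighbours, coloured or not, so the vertices outside [S] can be coloured in
    any order. *)
Lemma greedy_extension (S : {set T}) (c : T -> 'I_k) :
  proper_on S c -> (forall x, x \notin S -> #|[set y | f x y]| < k) ->
  exists c' : T -> 'I_k, proper_on setT c'.
Proof.
have [n] := ubnP #|~: S|; elim: n S c => // n IHn S c leSn cP ltk.
have [S0|[v vS]] := set_0Vmem (~: S).
  by exists c; rewrite -setC0 -S0 setCK.
have vNS : v \notin S by rewrite inE in vS.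
have [|c' c'P] := proper_on_setU1 (v := v) cP.
  apply: leq_ltn_trans (ltk v vNS); apply: subset_leq_card.
  by apply/subsetP=> y; rewrite !inE => /andP[].
apply: IHn c'P _ => [|x]; last by rewrite !inE negb_or => /andP[_ /ltk].
rewrite -ltnS; apply: leq_trans leSn; rewrite ltnS; apply: proper_card.
apply/properP; split; first by rewrite setCS subsetUr.
by exists v; rewrite // !inE eqxx.
Qed.

End Greedy.

(** * Conflicts: adjacency in the square without distances *)

Section Conflict.
Variables (T : finType) (e : rel T).

Definition conflict : rel T :=
  fun x y => (x != y) && (e x y || [exists z, e x z && e z y]).

Lemma square_conflict (x y : T) : square e x y -> conflict x y.
Proof.
rewrite /square /conflict => /andP[xy]; rewrite xy /=.
case E: (dist e x y) => [d|] // le2.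
have : walk e d x y.
  move: E; rewrite /dist; set s := [seq _ <- _ | _] => E.
  have : d \in s by case: s E => //= a s [->]; rewrite mem_head.
  by rewrite mem_filter => /andP[].
case/existsP=> p /andP[pP /eqP yE].
case: d p le2 pP yE {E} => [|[|[|d]]] p // _.
- by rewrite (tuple0 p) /= => _ xy'; rewrite xy' eqxx in xy.
- by case/tupleP: p => a p; rewrite (tuple0 p) /= andbT => exa <-; rewrite exa.
- case/tupleP: p => a p; case/tupleP: p => b p; rewrite (tuple0 p) /= andbT.
  move=> /andP[exa eab] <-; apply/orP; right.
  by apply/existsP; exists a; rewrite exa.
Qed.

Hypothesis e_sym : symmetric e.

Lemma conflict_sym : symmetric conflict.
Proof.
move=> x y; rewrite /conflict eq_sym e_sym; congr (_ && (_ || _)).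
by apply: eq_existsb => z; rewrite andbC e_sym [e z x]e_sym.
Qed.

Lemma conflict_irr : irreflexive conflict.
Proof. by move=> x; rewrite /conflict eqxx. Qed.

(** Union bound: a conflict of [v] is a neighbour [z] of [v], or a vertex other than [v] adjacent to
    some such [z]. *)
Lemma card_conflict_le (v : T) (S : {set T}) :
  #|[set y in S | conflict v y]| <=
  \sum_(z | e v z) ((z \in S) + #|[set y in S | e z y & y != v]|).
Proof.
pose N z := [set y in S | (y == z) || e z y && (y != v)].
apply: (@leq_trans #|\bigcup_(z | e v z) N z|).
  apply/subset_leq_card/subsetP=> y; rewrite !inE.
  case/and3P=> yS vy /orP[evy|/existsP[z /andP[evz ezy]]].
    by apply/bigcupP; exists y; rewrite // !inE yS eqxx.
  by apply/bigcupP; exists z; rewrite // !inE yS ezy (eq_sym y v) vy orbT.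
apply: (@leq_trans (\sum_(z | e v z) #|N z|)).
  apply: (big_ind2 (fun (A : {set T}) n => #|A| <= n)) => [|A a B b leA leB|//].
    by rewrite cards0.
  exact: leq_trans (leq_card_setU A B).1 (leq_add leA leB).
apply: leq_sum => z _.
have -> : N z = (S :&: [set z]) :|: [set y in S | e z y & y != v].
  by apply/setP=> y; rewrite !inE; case: (y \in S).
apply: leq_trans (leq_card_setU _ _).1 _; rewrite leq_add2r setIC.
case: (boolP (z \in S)) => zS.
  by rewrite (leq_trans (subset_leq_card (subsetIl _ _))) ?cards1.
rewrite leqn0 cards_eq0; apply/eqP/setP=> y; rewrite !inE.
by apply/negbTE; apply: contra zS => /andP[/eqP->].
Qed.

End Conflict.

(** * Maximum average degree as a bound on degree sums *)

Section Sparse.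
Variable T : finType.

(** The sum counts each edge induced by [S] twice, so this is mad < 4 for induced subgraphs, free of
    rationals. *)
Definition sparse (e : rel T) :=
  forall S : {set T}, S != set0 ->
    \sum_(x in S) deg_in e S x < 4 * #|S|.

Lemma eq_set2 (a b c d : T) :
  [set a; b] = [set c; d] -> (a, b) = (c, d) \/ (a, b) = (d, c).
Proof.
move=> E; have aE : a \in [set c; d] by rewrite -E set21.
have bE : b \in [set c; d] by rewrite -E set22.
have cE : c \in [set a; b] by rewrite E set21.
have dE : d \in [set a; b] by rewrite E set22.
move: aE bE cE dE; rewrite !in_set2.
by do 4![case/orP=> /eqP ?]; subst; (by left) || (by right).
Qed.

Lemma mad_sparse (e : rel T) : (mad e < 4%:R)%R -> sparse e.
Proof.
move=> mad4 S S0; pose h (p : T * T) := [set p.1; p.2].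
pose P := [set p : T * T | [&& p.1 \in S, p.2 \in S & e p.1 p.2]].
have -> : \sum_(x in S) deg_in e S x = #|P|.
  rewrite -sum1_card (eq_bigl (fun p : T * T =>
    (p.1 \in S) && (p.2 \in [set y in S | e p.1 y]))); last first.
    by move=> p; rewrite !inE.
  rewrite -(pair_big_dep (fun x => x \in S)
    (fun x y => y \in [set y in S | e x y]) (fun _ _ => 1)).
  by apply: eq_bigr => x _; rewrite sum1_card.
(* An edge arises from at most two ordered pairs, one for each orientation. *)
have leP : #|P| <= 2 * #|h @: P|.
  rewrite -sum1_card (partition_big_imset h) /= mulnC -sum_nat_const.
  apply: leq_sum => _ /imsetP[p0 _ ->]; rewrite sum1dep_card.
  apply: (@leq_trans #|[set p0; (p0.2, p0.1)]|); last by rewrite cards2; case: eqP.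
  apply/subset_leq_card/subsetP=> p; rewrite !inE => /andP[_ /eqP/eq_set2].
  by rewrite -!surjective_pairing => -[] ->; rewrite eqxx ?orbT.
apply: leq_ltn_trans leP _.
have : (average_degree (S, h @: P) <= mad e)%R.
  rewrite /mad; apply: le_bigmax_cond; rewrite /is_subgraph /= S0 andbT.
  apply/andP; split.
    apply/subsetP=> _ /imsetP[p pP ->]; apply: imset_f.
    by move: pP; rewrite !inE => /and3P[].
  apply/forall_inP=> _ /imsetP[p pP ->]; apply/subsetP=> x.
  by move: pP; rewrite !inE => /and3P[? ? _] /orP[]/eqP->.
move/le_lt_trans/(_ mad4); rewrite /average_degree /= ltr_pdivrMr; last first.
  by rewrite ltr0n card_gt0.
by rewrite -natrM ltr_nat.
Qed.

Lemma sparse_sub (e e' : rel T) : subrel e' e -> sparse e -> sparse e'.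
Proof.
move=> sub sp S S0; apply: leq_ltn_trans (sp S S0).
apply: leq_sum => x _; apply/subset_leq_card/subsetP=> y.
by rewrite !inE => /andP[-> /sub].
Qed.

End Sparse.

(** * Discharging and the reducible edge *)

Section Discharging.
Variables (T : finType) (e : rel T) (D : nat).
Hypotheses (e_sym : symmetric e) (degD : forall x, degree e x <= D).

Lemma degree_deg_in (x : T) : degree e x = deg_in e setT x.
Proof. by apply: eq_card => y; rewrite !inE. Qed.

Lemma deg_in_le (S : {set T}) (x : T) : deg_in e S x <= degree e x.
Proof. by apply/subset_leq_card/subsetP=> y; rewrite !inE => /andP[]. Qed.

Lemma deg_inU (A B : {set T}) (x : T) : [disjoint A & B] ->
  deg_in e (A :|: B) x = deg_in e A x + deg_in e B x.
Proof.
move=> dAB; rewrite /deg_in; have -> : [set y in A :|: B | e x y] =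
    [set y in A | e x y] :|: [set y in B | e x y].
  by apply/setP=> y; rewrite !inE andb_orl.
apply/eqP; rewrite (leq_card_setU _ _).2; apply: disjointW dAB.
  by apply/subsetP=> y; rewrite inE => /andP[].
by apply/subsetP=> y; rewrite inE => /andP[].
Qed.

(** Double counting: with [F y] the amount that [y] sends along each edge, what [A] receives is what
    [B] sends. *)
Lemma sum_deg_in (A B : {set T}) (F : T -> nat) :
  \sum_(x in A) \sum_(y in B | e x y) F y = \sum_(y in B) deg_in e A y * F y.
Proof.
rewrite (exchange_big_dep (mem B)) /= => [|x y _ /andP[]//].
apply: eq_bigr => y yB; rewrite -sum_nat_const; apply: eq_bigl => x.
by rewrite !inE yB e_sym.
Qed.

Lemma deg_in_D1 (S : {set T}) (z v : T) : v \in S -> e z v ->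
  deg_in e S z = 1 + #|[set y in S | e z y & y != v]|.
Proof.
move=> vS ezv; rewrite /deg_in (cardsD1 v) inE vS ezv; congr (_ + _).
by apply: eq_card => y; rewrite !inE andbC andbA.
Qed.

Definition light : {set T} := [set x | degree e x <= 3].
Definition cubic : {set T} := [set x | degree e x == 3].

(** Each of the at most 3 neighbours accounts for itself and at most [D - 1] others. *)
Lemma card_conflict_light (x : T) :
  x \in light -> #|[set y | conflict e x y]| <= 3 * D.
Proof.
rewrite inE => deg3.
have -> : [set y | conflict e x y] = [set y in setT | conflict e x y].
  by apply/setP=> y; rewrite !inE.
apply: leq_trans (card_conflict_le e x setT) _.
apply: (@leq_trans (\sum_(z in [set z | e x z]) D)); last first.
  by rewrite sum_nat_const leq_mul2r deg3 orbT.
rewrite big_mkcond [leqRHS]big_mkcond; apply: leq_sum => z _; rewrite inE.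
case: ifP => // exz; apply: leq_trans (degD z).
by rewrite degree_deg_in (@deg_in_D1 setT z x) ?in_setT // e_sym.
Qed.

Lemma degree_light (v : T) :
  degree e v = deg_in e (~: light) v + deg_in e light v.
Proof.
have dis : [disjoint ~: light & light] by rewrite disjoints_subset subxx.
by rewrite -(deg_inU v dis) setUC setUCr degree_deg_in.
Qed.

Lemma card_conflict_heavy (v : T) : v \notin light ->
  #|[set y in ~: light | conflict e v y]| <=
  \sum_(z in ~: light | e v z) deg_in e (~: light) z
    + deg_in e light v + deg_in e cubic v.
Proof.
move=> vL; have vCL : v \in ~: light by rewrite inE.
apply: leq_trans (card_conflict_le e v _) _.
rewrite (bigID (mem light)) /= [leqLHS]addnC -addnA; apply: leq_add.
  rewrite big_mkcond [leqRHS]big_mkcond; apply: leq_sum => z _.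
  rewrite in_setC andbC; case: ifP => // /andP[zL evz].
  by rewrite (deg_in_D1 vCL) ?zL // e_sym.
have cL : cubic \subset light by apply/subsetP=> z; rewrite !inE => /eqP->.
have -> : deg_in e cubic v =
    \sum_(z | e v z && (z \in light)) (z \in cubic : nat).
  rewrite /deg_in -sum1dep_card big_mkcond [RHS]big_mkcond.
  apply: eq_bigr => z _; case zc: (z \in cubic); last by case: ifP.
  by rewrite (subsetP cL _ zc) andbT.
have -> : deg_in e light v = \sum_(z | e v z && (z \in light)) 1.
  by rewrite sum1dep_card; apply: eq_card => z; rewrite !inE andbC.
rewrite -big_split; apply: leq_sum => z /andP[evz zL] /=.
have := @deg_in_le (~: light) z; rewrite (deg_in_D1 vCL) 1?e_sym // in_setC zL.
by move: zL; rewrite !inE; case: eqP => /=; lia.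
Qed.

(* [gift m / 30] is a lower bound of [(m - 4) / m] good enough for
   [sum_gift3], where the case D = 8 with values 8, 8, 4 is tight. *)
Definition gift (m : nat) : nat :=
  if 8 <= m then 15 else if 6 <= m then 10 else if m == 5 then 6 else 0.

(** If [a = 1], some [h z] is at least 7 and gives 10. If [a = 0], two values from 8 up give 30; a
    single one leaves at least 12 for two values below 8, which give at least 16; with none, the
    values are at least 7, 7, 6. *)
Lemma sum_gift3 (N : {set T}) (h : T -> nat) (a : nat) : 8 <= D ->
  (forall z, h z <= D) -> #|N| = 3 -> a <= 1 ->
  2 * D + 4 <= \sum_(z in N) h z + a ->
  30 <= \sum_(z in N) gift (h z) + 20 * a.
Proof.
move=> D8 hD; rewrite cardE -!big_enum.
case: (enum N) => [|x [|y [|z [|]]]] //= _.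
rewrite !big_cons !big_nil /gift; move: (hD x) (hD y) (hD z).
by do 3![case: ifP; [|case: ifP; [|case: ifP]]]; lia.
Qed.

(** Thirty times the claim that the final charge of [v] is nonnegative: gifts sent stand on the
    left, gifts received on the right. *)
Lemma discharge (v : T) : 8 <= D -> v \notin light ->
  (0 < deg_in e light v -> 3 * D < #|[set y in ~: light | conflict e v y]|) ->
  120 + deg_in e (~: light) v * gift (deg_in e (~: light) v) <=
  30 * deg_in e (~: light) v + 20 * deg_in e cubic v
    + \sum_(z in ~: light | e v z) gift (deg_in e (~: light) z).
Proof.
move=> D8 vL; have := card_conflict_heavy vL; have := degD v.
have : 3 < degree e v by rewrite inE -ltnNge in vL.
have mD z : deg_in e (~: light) z <= D := leq_trans (deg_in_le _ z) (degD z).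
have le_sum : \sum_(z in ~: light | e v z) deg_in e (~: light) z <=
    deg_in e (~: light) v * D.
  rewrite -sum_nat_const big_mkcond [leqRHS]big_mkcond; apply: leq_sum => z _.
  by rewrite !inE; case: ifP.
have ct : deg_in e cubic v <= deg_in e light v.
  apply/subset_leq_card/subsetP=> z; rewrite !inE.
  by move=> /andP[/eqP-> ->].
have sum3 : deg_in e (~: light) v = 3 -> deg_in e cubic v <= 1 ->
    2 * D + 4 <= \sum_(z in ~: light | e v z) deg_in e (~: light) z
      + deg_in e cubic v ->
    30 <= \sum_(z in ~: light | e v z) gift (deg_in e (~: light) z)
      + 20 * deg_in e cubic v.
  move=> m3 t1; have := sum_gift3 D8 mD m3 t1.
  by rewrite !(eq_bigl _ _ (fun z => in_set _ z)).
rewrite degree_light; move: sum3 le_sum ct.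
set m := deg_in e (~: light) v; set t := deg_in e cubic v.
set s := deg_in e light v; set S := \sum_(_ in _ | _) deg_in _ _ _.
set G := \sum_(_ in _ | _) _; set c := #|_|.
(* For [m >= 4] the initial charge pays for all gifts: [m * gift m <= 30 * (m - 4)]. *)
case: (ltnP 3 m) => [m4 _ _ _ _ _ _ _|].
  by rewrite /gift; do 3?[case: ifP]; lia.
(* Now [s > 0], so [3 * D < S + s + t], where [m + s <= D]. This excludes [m <= 1] and forces
   [t >= 3] if [m = 2]; if [m = 3], either [t >= 2] or [sum3] applies. *)
case: m => [|[|[|[|//]]]] _ sum3; rewrite /gift /=; lia.
Qed.

Lemma reducible_edge : 8 <= D -> sparse e -> (exists x y, e x y) ->
  exists u v, [/\ e u v, u \in light &
    v \notin light -> #|[set y in ~: light | conflict e v y]| <= 3 * D].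
Proof.
move=> D8 sp [x0 [y0 exy0]].
pose red p := [&& e p.1 p.2, p.1 \in light & (p.2 \notin light) ==>
  (#|[set y in ~: light | conflict e p.2 y]| <= 3 * D)].
case: (pickP red) => [[u v] /= /and3P[euv uL /implyP H]|nored]; first by exists u, v.
have nr u v : e u v -> u \in light -> v \notin light /\
    3 * D < #|[set y in ~: light | conflict e v y]|.
  move=> euv uL; have := nored (u, v); rewrite /red /= euv uL /=.
  by move/negbT; rewrite negb_imply -ltnNge => /andP.
have cL : cubic \subset light by apply/subsetP=> z; rewrite !inE => /eqP->.
have dis : [disjoint ~: light & cubic].
  by rewrite disjoint_sym (disjointWl cL) // -setI_eq0 setICr.
have S0 : ~: light :|: cubic != set0.
  apply/set0Pn; case: (boolP (x0 \in light)) => [/(nr _ _ exy0)[yL _]|xL].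
    by exists y0; rewrite in_setU in_setC yL.
  by exists x0; rewrite in_setU in_setC xL.
have := sp _ S0; rewrite cardsU (disjoint_setI0 dis) cards0 subn0.
have -> (F : T -> nat) : \sum_(x in ~: light :|: cubic) F x =
    \sum_(x in ~: light) F x + \sum_(x in cubic) F x.
  by rewrite -bigU //; apply: eq_bigl => x; rewrite inE.
rewrite (eq_bigr _ (fun x _ => deg_inU x dis)) big_split /=.
(* Light vertices are independent, so all three neighbours of a cubic vertex lie outside [light]. *)
have cub x : x \in cubic -> deg_in e (~: light) x = 3.
  move=> xc; have xL := subsetP cL x xc.
  move: (degree_light x); move: (xc); rewrite inE => /eqP->.
  rewrite [deg_in e light x](_ : _ = 0) ?addn0 //.
  apply/eqP; rewrite cards_eq0; apply/eqP/setP=> y; rewrite in_set0 inE.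
  by apply/negP=> /andP[yL exy]; have [] := nr _ _ exy xL; rewrite yL.
have sum_cubic : \sum_(x in ~: light) deg_in e cubic x = #|cubic| * 3.
  rewrite -sum_nat_const -(eq_bigr _ cub).
  have := sum_deg_in (~: light) cubic (fun=> 1).
  under eq_bigr do rewrite sum1dep_card; under [RHS]eq_bigr do rewrite muln1.
  by [].
rewrite sum_cubic.
have : #|cubic| * 3 <= \sum_(x in cubic) deg_in e (~: light :|: cubic) x.
  rewrite -sum_nat_const; apply: leq_sum => x xc.
  by rewrite deg_inU // cub // leq_addr.
have : \sum_(v in ~: light)
    (120 + deg_in e (~: light) v * gift (deg_in e (~: light) v)) <=
  \sum_(v in ~: light) (30 * deg_in e (~: light) v + 20 * deg_in e cubic v
    + \sum_(z in ~: light | e v z) gift (deg_in e (~: light) z)).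
  apply: leq_sum => v; rewrite inE => vL; apply: discharge => // /card_gt0P[u].
  by rewrite inE => /andP[uL evu]; have [] := nr u v; rewrite 1?e_sym.
have distr a (F : T -> nat) :
    \sum_(x in ~: light) a * F x = a * \sum_(x in ~: light) F x.
  by rewrite big_distrr.
(* Gifts sent and received cancel. With [M] the sum of [deg_in e (~: light)] over [~: light], this
   leaves [120 * #|~: light| <= 30 * M + 60 * #|cubic|], while sparsity gives [M + 6 * #|cubic| < 4
   * #|~: light| + 4 * #|cubic|]. *)
rewrite 3!big_split /= sum_deg_in !distr sum_nat_const sum_cubic.
lia.
Qed.

End Discharging.

(** * Induction on the number of edges *)

(** Every edge of a walk of length at most 2 between two vertices of [S] contains one of its ends,
    hence is not [uv]. *)
Lemma delete_edge_coloring (T : finType) (e : rel T) (k : nat) (u v : T)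
    (c : T -> 'I_k) (S : {set T}) :
  u \notin S -> v \notin S ->
  proper_on (conflict [rel x y | e x y && ([set x; y] != [set u; v])]) setT c ->
  proper_on (conflict e) S c.
Proof.
move=> uS vS cP x y xS yS /andP[xy H]; apply: cP; rewrite ?in_setT //.
rewrite /conflict xy /=.
have neq a b : (a \in S) || (b \in S) -> [set a; b] != [set u; v].
  apply: contraTneq => E; rewrite negb_or.
  have : a \in [set u; v] by rewrite -E set21.
  have : b \in [set u; v] by rewrite -E set22.
  by do 2!case/set2P=> ->; rewrite ?uS ?vS.
case/orP: H => [exy|/existsP[z /andP[exz ezy]]]; first by rewrite exy neq ?xS.
by apply/orP; right; apply/existsP; exists z; rewrite exz ezy !neq ?xS ?yS ?orbT.
Qed.

(** [D] only bounds the degrees, so it stays fixed when an edge is deleted. *)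
Lemma sparse_colorable (T : finType) (e : rel T) (D : nat) :
  8 <= D -> symmetric e -> (forall x, degree e x <= D) ->
  sparse e -> exists c : T -> 'I_(3 * D + 1), proper_on (conflict e) setT c.
Proof.
move=> D8; have [n] := ubnP #|[set p | e p.1 p.2]|.
elim: n e => // n IHn e len e_sym degD sp.
case: (pickP (fun p => e p.1 p.2)) => [[x y] /= exy|e0]; last first.
  have ord0 : 'I_(3 * D + 1) by rewrite addn1; exact: ord0.
  exists (fun=> ord0) => x y _ _ /andP[_ /orP[|/existsP[z]]].
    by have := e0 (x, y); rewrite /= => ->.
  by have := e0 (x, z); rewrite /= => ->.
have [|u [v [euv uL vP]]] := reducible_edge e_sym degD D8 sp; first by exists x, y.
pose e' := [rel x y | e x y && ([set x; y] != [set u; v])].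
have sub : subrel e' e by move=> a b /andP[].
have [|||| c cP] := IHn e'.
- rewrite -ltnS; apply: leq_trans len; rewrite ltnS; apply: proper_card.
  apply/properP; split; first by apply/subsetP=> p; rewrite !inE => /sub.
  by exists (u, v); rewrite !inE //= eqxx andbF.
- by move=> a b; rewrite /= e_sym setUC.
- move=> a; apply: leq_trans (degD a); apply/subset_leq_card/subsetP=> b.
  by rewrite !inE => /sub.
- exact: sparse_sub sp.
have ltL a : a \in light e -> #|[set y | conflict e a y]| < 3 * D + 1.
  by rewrite addn1 ltnS; apply: card_conflict_light.
have sym := conflict_sym e_sym; have irr := conflict_irr e.
have cS : proper_on (conflict e) (~: light e :\ v) c.
  by apply: delete_edge_coloring cP; rewrite in_setD1 ?eqxx // in_setC uL andbF.
have [c' c'P] : exists c' : T -> 'I_(3 * D + 1),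
    proper_on (conflict e) (~: light e) c'.
  (* A [v] outside [light e] is recoloured while all light vertices are uncoloured, so only its
     conflicts in [~: light e] count. *)
  case: (boolP (v \in light e)) => vL.
    by exists c => a b aS bS; apply: cS; rewrite in_setD1 ?aS ?bS andbT;
      apply: contraTneq vL => <-; rewrite -in_setC.
  rewrite -(setD1K (_ : v \in ~: light e)) ?in_setC //.
  apply: proper_on_setU1 cS _ => //; rewrite addn1 ltnS.
  apply: leq_trans (vP vL); apply/subset_leq_card/subsetP=> a.
  by rewrite !inE => /andP[/andP[_ ->]].
apply: (greedy_extension sym irr c'P) => a.
by rewrite in_setC negbK; apply: ltL.
Qed.

Theorem theorem4 (T : finType) (e : rel T)
    (e_sym : symmetric e) (e_irr : irreflexive e)
    (mad_lt4 : (mad e < 4%:R)%R) (Delta_ge8 : 8 <= max_degree e) :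
  chromatic_number (@square_irr T e) <= 3 * max_degree e + 1.
Proof.
have [|c cP] := sparse_colorable Delta_ge8 e_sym _ (mad_sparse mad_lt4).
  by move=> x; apply: (@leq_bigmax _ (degree e)).
rewrite /chromatic_number; case: ex_minnP => m _; apply.
apply/existsP; exists [ffun x => c x]; apply/forallP=> x; apply/forallP=> y.
by apply/implyP=> /square_conflict cxy; rewrite !ffunE cP ?in_setT.
Qed.
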